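(* Let $H$ be a complex Hilbert space, let $T:H\to H$ be a nonzero bounded linear operator, and let $\lambda\in\mathbb{C}\setminus\{0\}$, $r>0$ with $|\lambda|>r$. If $$\|T-\lambda I\|\le r,$$ then $$0\le \|T\|^2-w^2(T)\le \frac{2r^2}{|\lambda|+\sqrt{|\lambda|^2-r^2}}\,w(T).$$
   Context: $I$ denotes the identity operator on $H$ and $\|\cdot\|$ the operator norm. The numerical radius of a bounded linear operator $T$ on $H$ is $w(T)=\sup\{|\langle Tx,x\rangle| : x\in H,\ \|x\|=1\}$, and $w^2(T)$ means $(w(T))^2$. *)

(* Defs.v *)
From HB Require Import structures.
From mathcomp Require Import all_boot all_order all_algebra.
From mathcomp Require Import complex.
From mathcomp Require Import all_classical all_reals all_analysis.

Set Implicit Arguments.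
Unset Strict Implicit.
Unset Printing Implicit Defensive.

Import Order.TTheory GRing.Theory Num.Theory.
Import numFieldNormedType.Exports.

Local Open Scope classical_set_scope.
Local Open Scope ring_scope.

(* Over the scalar field R[i] the library norm `|x| takes values in R[i]
   (as a nonnegative real element); rnorm is that number read in R.  It applies
   both to scalars z : R[i] (the modulus) and to vectors. *)
Definition rnorm (R : realType) (V : normedZmodType R[i]) (x : V) : R :=
  complex.Re `|x|.

(* A complex Hilbert space is a complete normed space over R[i] together with
   an inner product, linear in its first argument and conjugate-linear in the
   second, that induces the norm. *)
Definition hilbert_dot (R : realType) (H : completeNormedModType R[i])
    (dot : {dot H for Num.conj}) : Prop :=
  forall x : H, rnorm x ^+ 2 = complex.Re (dot x x).

Definition bounded_operator (R : realType) (H : normedModType R[i])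
    (T : H -> H) : Prop :=
  exists M : R, forall x : H, rnorm (T x) <= M * rnorm x.

(* sup is 0 on sets that are empty or unbounded above, so opnorm and
   numerical_radius carry their usual meaning for bounded T only; the numerical
   radius of the operator on the zero space is 0. *)
Definition opnorm (R : realType) (H : normedModType R[i]) (T : H -> H) : R :=
  sup [set rnorm (T x) | x in [set x : H | rnorm x <= 1]].

Definition numerical_radius (R : realType) (H : completeNormedModType R[i])
    (dot : {dot H for Num.conj}) (T : H -> H) : R :=
  sup [set rnorm (dot (T x) x) | x in [set x : H | rnorm x = 1]].

(* Main.v *)
(* For a unit vector x, expanding ||T x - lam x||^2 <= r^2 gives, with
   s = sqrt (|lam|^2 - r^2),
     ||T x||^2 + s^2 <= 2 Re (conj lam <T x, x>) <= 2 |lam| w(T),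
   hence ||T||^2 <= 2 |lam| w(T) - s^2.  As r^2 / (|lam| + s) = |lam| - s, the
   upper bound then amounts to (w(T) - s)^2 >= 0.  The lower bound w(T) <= ||T||
   is the Cauchy-Schwarz inequality. *)
Require Import Defs.
From HB Require Import structures.
From mathcomp Require Import all_boot all_order all_algebra.
From mathcomp Require Import complex.
From mathcomp Require Import all_classical all_reals all_analysis.
From mathcomp Require Import ring lra.

Set Implicit Arguments.
Unset Strict Implicit.
Unset Printing Implicit Defensive.

Import Order.TTheory GRing.Theory Num.Theory.
Import numFieldNormedType.Exports.

Local Open Scope ring_scope.

(** Bridge between the two norms: library facts stated in [R[i]] are rewritten with it and then
    descend to [R] by injectivity or monotonicity of the embedding. *)
Lemma rnormE (R : realType) (V : normedZmodType R[i]) (x : V) :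
  `|x| = (rnorm x)%:C%C.
Proof. by rewrite /rnorm RRe_real // ger0_real. Qed.

Lemma rnorm_ge0 (R : realType) (V : normedZmodType R[i]) (x : V) :
  0 <= rnorm x.
Proof. by have := normr_ge0 x; rewrite rnormE lecR. Qed.

Lemma rnorm_eq0 (R : realType) (V : normedZmodType R[i]) (x : V) :
  (rnorm x == 0) = (x == 0).
Proof.
rewrite -(normr_eq0 x) rnormE.
by apply/eqP/eqP => [->//|/(congr1 (@complex.Re R))].
Qed.

Lemma rnormB (R : realType) (V : normedZmodType R[i]) (x y : V) :
  rnorm (x - y) <= rnorm x + rnorm y.
Proof. by have := ler_normB x y; rewrite !rnormE -rmorphD lecR. Qed.

Lemma rnormM (R : realType) (a b : R[i]) : rnorm (a * b) = rnorm a * rnorm b.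
Proof. by rewrite [LHS]/rnorm normrM !rnormE -rmorphM. Qed.

Lemma rnorm_conj (R : realType) (a : R[i]) : rnorm a^* = rnorm a.
Proof. by rewrite /rnorm norm_conjC. Qed.

Lemma rnormZ (R : realType) (V : normedModType R[i]) (a : R[i]) (x : V) :
  rnorm (a *: x) = rnorm a * rnorm x.
Proof. by rewrite [LHS]/rnorm normrZ !rnormE -rmorphM. Qed.

Lemma Re_le_rnorm (R : realType) (z : R[i]) : complex.Re z <= rnorm z.
Proof.
by apply: le_trans (ler_norm _) _; have := normc_ge_Re z; rewrite rnormE lecR.
Qed.

Section InnerProduct.
Variables (R : realType) (H : completeNormedModType R[i]).
Variables (dot : {dot H for Num.conj}).
Hypothesis hdot : hilbert_dot dot.

Lemma sqr_rnormBZ (u v : H) (a : R[i]) :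
  rnorm (u - a *: v) ^+ 2 =
  rnorm u ^+ 2 + (rnorm a * rnorm v) ^+ 2
    - 2 * complex.Re (a^* * dot u v).
Proof.
rewrite -rnormZ !hdot dnormB -[a^* * _](linearZr_LR dot) /=.
(* The cross terms of the expansion are conjugate to each other, so their sum has real part
   [e + e]. *)
move: (dot u u) (dot (a *: v) (a *: v)) (dot u (a *: v)) => [p p'] [q q'] [e e'] /=.
by rewrite mulr_natl mulr2n.
Qed.

(** Cauchy-Schwarz for a unit vector: subtracting from [u] its projection on [v] leaves a vector of
    squared norm [rnorm u ^+ 2 - rnorm (dot u v) ^+ 2], which is nonnegative. *)
Lemma rnorm_dot_le (u v : H) : rnorm v = 1 -> rnorm (dot u v) <= rnorm u.
Proof.
move=> v1; rewrite -(@ler_pXn2r _ 2) ?nnegrE ?rnorm_ge0//.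
have := sqr_ge0 (rnorm (u - dot u v *: v)).
rewrite sqr_rnormBZ v1 mulr1 mulrC -normCKC rnormE -rmorphXn/=.
lra.
Qed.

End InnerProduct.

Section OperatorNorm.
Variables (R : realType) (H : normedModType R[i]).

Lemma rnorm_le_opnorm (T : H -> H) (x : H) :
  bounded_operator T -> rnorm x <= 1 -> rnorm (T x) <= opnorm T.
Proof.
move=> [M TM] x1; apply: ub_le_sup; last by exists x.
(* [M] comes without a sign, hence the absolute value. *)
exists `|M| => _ [y /= y1 <-]; apply: le_trans (TM y) _.
apply: le_trans (ler_norm _) _; rewrite normrM (ger0_norm (rnorm_ge0 _)).
exact: ler_piMr.
Qed.

(** By homogeneity the unit sphere controls the whole unit ball over which [opnorm] is taken;
    [0 <= c] covers the zero vector. *)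
Lemma opnorm_le (T : {linear H -> H}) (c : R) :
  0 <= c -> (forall x, rnorm x = 1 -> rnorm (T x) <= c) -> opnorm T <= c.
Proof.
move=> c0 Tc; apply: ge_sup.
  by exists (rnorm (T 0)), 0 => //=; rewrite /rnorm normr0.
move=> _ [x /= x1 <-]; have [->|x0] := eqVneq x 0.
  by rewrite linear0 /rnorm normr0.
have nx0 : rnorm x != 0 by rewrite rnorm_eq0.
have xE : x = `|x| *: (`|x|^-1 *: x).
  by rewrite scalerA divff ?scale1r// normr_eq0.
have n1 : rnorm (`|x|^-1 *: x) = 1.
  by rewrite /rnorm normrZV// unitfE normr_eq0.
rewrite xE linearZ rnormZ {1}/rnorm normr_id -/(rnorm x).
apply: le_trans (_ : 1 * c <= _); last by rewrite mul1r.
by apply: ler_pM => //; [exact: rnorm_ge0 | exact: rnorm_ge0 | exact: Tc].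
Qed.

End OperatorNorm.

(** Cauchy-Schwarz bounds the defining set by [opnorm T], so its [sup] is a genuine upper bound and
    not the default value. *)
Lemma numerical_radius_ub (R : realType) (H : completeNormedModType R[i])
    (dot : {dot H for Num.conj}) (T : H -> H) (x : H) :
  hilbert_dot dot -> bounded_operator T -> rnorm x = 1 ->
  rnorm (dot (T x) x) <= numerical_radius dot T.
Proof.
move=> hdot bT x1; apply: ub_le_sup; last by exists x.
exists (opnorm T) => _ [y /= y1 <-].
by apply: le_trans (rnorm_dot_le hdot _ y1) (rnorm_le_opnorm bT _); rewrite y1.
Qed.

Theorem theorem10 (R : realType) (H : completeNormedModType R[i])
    (dot : {dot H for Num.conj}) (hdot : hilbert_dot dot)
    (T : {linear H -> H}) (T_bounded : bounded_operator T)
    (T_neq0 : exists x : H, T x != 0)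
    (lam : R[i]) (r : R) (lam_neq0 : lam != 0) (r_gt0 : 0 < r)
    (r_lt_lam : r < rnorm lam)
    (hT : opnorm (fun x : H => T x - lam *: x) <= r) :
  0 <= opnorm T ^+ 2 - numerical_radius dot T ^+ 2
    <= 2 * r ^+ 2 / (rnorm lam + Num.sqrt (rnorm lam ^+ 2 - r ^+ 2))
       * numerical_radius dot T.
Proof.
(* A vector outside the kernel is nonzero and can be normalized. The unit vector makes the set
   defining [w] nonempty and yields the signs needed below. *)
have [x0 x0_1] : exists x : H, rnorm x = 1.
  have [x Tx0] := T_neq0; exists (`|x|^-1 *: x).
  rewrite /rnorm normrZV// unitfE normr_eq0.
  by apply: contra_neq Tx0 => ->; rewrite linear0.
set w := numerical_radius dot T; set L := rnorm lam.
set s := Num.sqrt _.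
have L_gt0 : 0 < L by exact: lt_trans r_lt_lam.
have s2 : s ^+ 2 = L ^+ 2 - r ^+ 2.
  rewrite sqr_sqrtr // subr_ge0 ler_pXn2r ?nnegrE ?ltW //.
have s_ge0 : 0 <= s by exact: sqrtr_ge0.
have w_ge0 : 0 <= w.
  by apply: le_trans (numerical_radius_ub hdot T_bounded x0_1); exact: rnorm_ge0.
(* Without boundedness the [sup] in [hT] could be the default 0, and [hT] would say nothing about
   individual vectors. *)
have bTlam : bounded_operator (fun x : H => T x - lam *: x).
  have [M TM] := T_bounded; exists (M + L) => x.
  by rewrite mulrDl -rnormZ; apply: le_trans (rnormB _ _) _; rewrite lerD2r.
have Tx_le x : rnorm x = 1 -> rnorm (T x) ^+ 2 <= 2 * L * w - s ^+ 2.
  move=> x1.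
  have : rnorm (T x - lam *: x) ^+ 2 <= r ^+ 2.
    rewrite ler_pXn2r ?nnegrE ?rnorm_ge0 ?(ltW r_gt0)//; apply: le_trans hT.
    by apply: (rnorm_le_opnorm bTlam); rewrite x1.
  rewrite (sqr_rnormBZ hdot) x1 mulr1 -/L.
  have := Re_le_rnorm (lam^* * dot (T x) x); rewrite rnormM rnorm_conj -/L.
  have := numerical_radius_ub hdot T_bounded x1; rewrite -/w.
  (* Scaling the bound by [w] with [L] makes the remaining inequality linear in the products that
     occur. *)
  rewrite -(ler_pM2l L_gt0) s2; lra.
(* [opnorm_le] bounds the norm and not its square, so it will be applied with the square root of
   this quantity. *)
have B_ge0 : 0 <= 2 * L * w - s ^+ 2.
  by apply: le_trans (Tx_le _ x0_1); exact: sqr_ge0.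
have T_ge0 : 0 <= opnorm T.
  by apply: le_trans (rnorm_le_opnorm T_bounded (x := x0) _);
    rewrite ?rnorm_ge0 ?x0_1.
have T_le : opnorm T ^+ 2 <= 2 * L * w - s ^+ 2.
  rewrite -(sqr_sqrtr B_ge0) ler_pXn2r ?nnegrE ?sqrtr_ge0//.
  apply: opnorm_le => [|x x1]; first exact: sqrtr_ge0.
  by rewrite -(ger0_norm (rnorm_ge0 (T x))) -sqrtr_sqr ler_wsqrtr // Tx_le.
have w_le : w <= opnorm T.
  apply: ge_sup; first by exists (rnorm (dot (T x0) x0)), x0.
  move=> _ [x /= x1 <-]; apply: le_trans (rnorm_dot_le hdot _ x1) _.
  by apply: rnorm_le_opnorm; rewrite ?x1.
have -> : 2 * r ^+ 2 / (L + s) = 2 * (L - s).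
  have -> : r ^+ 2 = (L - s) * (L + s) by rewrite -subr_sqr s2; ring.
  by rewrite mulrA mulfK// gt_eqF// ltr_wpDr.
apply/andP; split; first by rewrite subr_ge0 ler_pXn2r ?nnegrE.
have := sqr_ge0 (w - s); rewrite sqrrB; lra.
Qed.
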